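(* Let $\mathbf{X},\mathbf{Y}$ be quasivarieties and let $\langle\zeta,f\rangle:Tm(\mathcal{L}_{\mathbf{X}})\to Tm(\mathcal{L}_{\mathbf{Y}})$ be a sober translation. Then the assignment $\tau:\Xi(\mathbf{X})\to\Xi^f(\mathbf{Y})$, $\tau(\mathbf{K})=\{\mathcal{A}\in\mathbf{Y}:\theta(\mathcal{A})\in\mathbf{K}\}$, is a lattice isomorphism.
   Context: A quasivariety is a class of similar algebras closed under isomorphisms, subalgebras and reduced products. $\mathbf{X},\mathbf{Y}$ have languages $\mathcal{L}_{\mathbf{X}},\mathcal{L}_{\mathbf{Y}}$; $\Xi(\mathbf{K})$ is the lattice of subquasivarieties of $\mathbf{K}$. For a class $\mathbf{K}$, $\Phi\vDash_{\mathbf{K}}\lambda\approx\gamma$ means every assignment into an algebra of $\mathbf{K}$ satisfying $\Phi$ satisfies $\lambda\approx\gamma$. Selective translation: $\zeta$ assigns to each $n$-ary symbol $g\in\mathcal{L}_{\mathbf{X}}$ an $n$-ary term $\zeta(g)$ of $\mathcal{L}_{\mathbf{Y}}$; $f(x)$ is a unary term of $\mathcal{L}_{\mathbf{Y}}$ (the selector). For an infinite variable set $V$ define $\zeta_*:Tm(\mathcal{L}_{\mathbf{X}},V)\to Tm(\mathcal{L}_{\mathbf{Y}},V)$ by $\zeta_*(x)=f(x)$ on variables and $\zeta_*(g(\phi_1,\dots,\phi_n))=\zeta(g)(\zeta_*(\phi_1),\dots,\zeta_*(\phi_n))$ (in particular $\zeta_*(c)=\zeta(c)$ for constants), and $\zeta^*(\Phi)=\{\zeta_*(\delta)\approx\zeta_*(\gamma):\delta\approx\gamma\in\Phi\}$.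 $\langle\zeta,f\rangle$ is a selective translation if: (i) $\vDash_{\mathbf{Y}}f(f(x))\approx f(x)$; (ii) $\Phi\vDash_{\mathbf{X}}\lambda\approx\gamma$ implies $\zeta^*(\Phi)\cup\{f(x)\approx x:x\in V\}\vDash_{\mathbf{Y}}\zeta^*(\lambda\approx\gamma)$; (iii) for each $n$-ary $g\in\mathcal{L}_{\mathbf{X}}$, $\{f(x_i)\approx x_i:i\le n\}\vDash_{\mathbf{Y}}f(\zeta(g)(x_1,\dots,x_n))\approx\zeta(g)(x_1,\dots,x_n)$. For $\mathcal{A}\in\mathbf{Y}$, $\mathcal{A}^f=\{a\in A:f(a)=a\}$, and $\theta(\mathcal{A})\in\mathbf{X}$ is the algebra with universe $\mathcal{A}^f$ and operations $g^{\theta(\mathcal{A})}=\zeta(g)^{\mathcal{A}}$ restricted to $\mathcal{A}^f$. With restriction on homomorphisms, $\theta:\mathbf{Y}\to\mathbf{X}$ is a right adjoint functor; $\mathcal{F}:\mathbf{X}\to\mathbf{Y}$ is its left adjoint, with unit $\eta:1\Rightarrow\theta\mathcal{F}$ and counit $\varepsilon:\mathcal{F}\theta\Rightarrow1$. A selective translation is strongly selective if $\eta$ is an isomorphism, and sober if moreover $\varepsilon$ is pointwise injective and $\mathcal{F}$ preserves injective homomorphisms. For $\mathcal{A},\mathcal{B}\in\mathbf{Y}$, $\mathcal{B}\preceq_f\mathcal{A}$ means $\mathcal{B}$ is a subalgebra of $\mathcal{A}$ with $\mathcal{B}^f=\mathcal{A}^f$; for $\mathbf{K}\in\Xi(\mathbf{Y})$,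 $\mathbf{K}^\uparrow=\{\mathcal{A}\in\mathbf{Y}:\exists\mathcal{B}\in\mathbf{K},\ \mathcal{B}\preceq_f\mathcal{A}\}$; $\Xi^f(\mathbf{Y})=\{\mathbf{K}^\uparrow:\mathbf{K}\in\Xi(\mathbf{Y})\}$ is the complete lattice (under inclusion) of $\mathsf{PAt}$-$f$-quasivarieties. *)

(* Defs.v *)
From Stdlib Require List Fin.
From HB Require Import structures.
From mathcomp Require Import all_boot all_order.
From mathcomp Require Import mathcomp_extra boolp classical_sets functions.
From mathcomp Require Import cardinality filter.

Set Implicit Arguments.
Unset Strict Implicit.
Unset Printing Implicit Defensive.

Local Open Scope classical_set_scope.

Record category := Category {
  obj :> Type;
  mor : obj -> obj -> Type;
  idm : forall a, mor a a;
  mor_comp : forall a b c, mor b c -> mor a b -> mor a c;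
  comp_idl : forall a b (u : mor a b), mor_comp (idm b) u = u;
  comp_idr : forall a b (u : mor a b), mor_comp u (idm a) = u;
  compA : forall a b c d (u : mor c d) (v : mor b c) (w : mor a b),
    mor_comp u (mor_comp v w) = mor_comp (mor_comp u v) w
}.
Arguments mor {c0} _ _.
Arguments idm {c0} _.
Arguments mor_comp {c0 a b c} _ _.

Record functor (C D : category) := Functor {
  fobj :> C -> D;
  fmap : forall a b, mor a b -> mor (fobj a) (fobj b);
  fmap_id : forall a, fmap (idm a) = idm (fobj a);
  fmap_comp : forall a b c (u : mor b c) (v : mor a b),
    fmap (mor_comp u v) = mor_comp (fmap u) (fmap v)
}.
Arguments fmap {C D} _ {a b} _.

Record adjunction (C D : category) (F : functor C D) (G : functor D C) :=
  Adjunction {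
  unit_ : forall c : C, mor c (G (F c));
  counit_ : forall d : D, mor (F (G d)) d;
  unit_natural : forall (a b : C) (u : mor a b),
    mor_comp (fmap G (fmap F u)) (unit_ a) = mor_comp (unit_ b) u;
  counit_natural : forall (a b : D) (u : mor a b),
    mor_comp u (counit_ a) = mor_comp (counit_ b) (fmap F (fmap G u));
  triangle_left : forall c : C,
    mor_comp (counit_ (F c)) (fmap F (unit_ c)) = idm (F c);
  triangle_right : forall d : D,
    mor_comp (fmap G (counit_ d)) (unit_ (G d)) = idm (G d)
}.

Definition is_iso (C : category) (a b : C) (u : mor a b) : Prop :=
  exists v : mor b a, mor_comp v u = idm a /\ mor_comp u v = idm b.

Record signature := Signature { symbol :> Type; arity : symbol -> nat }.

(* Arguments are indexed by [Fin.t n], which lives in [Set], rather than by the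
   ordinal type of MathComp, whose universe would otherwise bound those of term
   algebras and index types from below. Universes are nonempty. *)
Record algebra (L : signature) := Algebra {
  carrier :> Type;
  interp : forall g : L, (Fin.t (arity g) -> carrier) -> carrier;
  algebra_nonempty : inhabited carrier
}.
Arguments interp {L} a g _.

Inductive term (L : signature) (V : Type) : Type :=
| Var of V
| App (g : L) of (Fin.t (arity g) -> term L V).
Arguments Var {L V} _.
Arguments App {L V} g _.

Section Terms.
Variable L : signature.

Fixpoint term_subst V W (s : V -> term L W) (t : term L V) : term L W :=
  match t with
  | Var x => s x
  | App g ts => App g (fun i => term_subst s (ts i))
  end.

Fixpoint eval (A : algebra L) V (h : V -> A) (t : term L V) : A :=
  match t with
  | Var x => h x
  | App g ts => interp A g (fun i => eval h (ts i))
  end.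

Definition equation V := (term L V * term L V)%type.

Definition satisfies (A : algebra L) V (h : V -> A) (e : equation V) : Prop :=
  eval h e.1 = eval h e.2.

Definition consequence (K : algebra L -> Prop) V
    (Phi : set (equation V)) (e : equation V) : Prop :=
  forall A : algebra L, K A -> forall h : V -> A,
    (forall e', Phi e' -> satisfies h e') -> satisfies h e.

Lemma eval_subst (A : algebra L) V W (s : V -> term L W) (h : W -> A) t :
  eval h (term_subst s t) = eval (fun x => eval h (s x)) t.
Proof.
by elim: t => //= g ts IH; congr interp; apply: funext => i; exact: IH.
Qed.

Lemma eq_eval (A : algebra L) V (h k : V -> A) t :
  h =1 k -> eval h t = eval k t.
Proof. by move=> hk; have -> : h = k by apply: funext. Qed.

End Terms.

Section FiniteIndices.

Fixpoint fin_enum n : seq (Fin.t n) :=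
  if n is n'.+1 then Fin.F1 :: [seq Fin.FS i | i <- fin_enum n'] else [::].

Lemma mem_fin_enum n (i : Fin.t n) : List.In i (fin_enum n).
Proof.
by elim: n / i => [n|n i IH] /=; [left|right; exact: List.in_map].
Qed.

Lemma filter_fin n T (F : set_system T) {FF : Filter F} (P : Fin.t n -> set T) :
  (forall i, F (P i)) -> F [set x | forall i, P i x].
Proof.
move=> FP; suff: F [set x | forall i, List.In i (fin_enum n) -> P i x].
  by apply: (@filterS _ F) => x Px i; exact/Px/mem_fin_enum.
elim: (fin_enum n) => [|j s IH].
  by apply: (@filterS _ F _ setT _ _ filterT) => x _ i [].
apply: (@filterS _ F _ _ _ _ (filterI (FP j) IH)) => x [Pj Ps] i [<-//|/Ps].
exact.
Qed.

End FiniteIndices.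

Record hom (L : signature) (A B : algebra L) := Hom {
  hom_fun :> A -> B;
  hom_interp : forall (g : L) (x : Fin.t (arity g) -> A),
    hom_fun (interp A g x) = interp B g (fun i => hom_fun (x i))
}.

Section Constructions.
Variable L : signature.
Implicit Types A B C : algebra L.

Lemma hom_ext A B (u v : hom A B) : u =1 v -> u = v.
Proof.
case: u v => [u hu] [v hv] /= /funext uv; subst v.
by congr Hom; exact: Prop_irrelevance.
Qed.

Lemma id_hom_subproof A (g : L) (x : Fin.t (arity g) -> A) :
  idfun (interp A g x) = interp A g (fun i => idfun (x i)).
Proof. by []. Qed.

Definition id_hom A : hom A A := Hom (@id_hom_subproof A).

Lemma comp_hom_subproof A B C (u : hom B C) (v : hom A B)
    (g : L) (x : Fin.t (arity g) -> A) :
  (u \o v) (interp A g x) = interp C g (fun i => (u \o v) (x i)).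
Proof. by rewrite /= hom_interp hom_interp. Qed.

Definition comp_hom A B C (u : hom B C) (v : hom A B) : hom A C :=
  Hom (@comp_hom_subproof A B C u v).

Lemma comp_homIl A B (u : hom A B) : comp_hom (id_hom B) u = u.
Proof. exact: hom_ext. Qed.

Lemma comp_homIr A B (u : hom A B) : comp_hom u (id_hom A) = u.
Proof. exact: hom_ext. Qed.

Lemma comp_homA A B C D (u : hom C D) (v : hom B C) (w : hom A B) :
  comp_hom u (comp_hom v w) = comp_hom (comp_hom u v) w.
Proof. exact: hom_ext. Qed.

Lemma hom_eval A B (u : hom A B) V (h : V -> A) t :
  u (eval h t) = eval (u \o h) t.
Proof.
elim: t => //= g ts IH; rewrite hom_interp.
by congr interp; apply: funext => i; exact: IH.
Qed.

Definition isomorphic A B : Prop := exists u : hom A B, bijective u.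

Record subuniverse A := Subuniverse {
  sub_set :> A -> Prop;
  sub_nonempty : exists a, sub_set a;
  sub_closed : forall (g : L) (x : Fin.t (arity g) -> A),
    (forall i, sub_set (x i)) -> sub_set (interp A g x)
}.

Lemma inj_surj_bij (T U : Type) (u : T -> U) :
  injective u -> (forall y, exists x, u x = y) -> bijective u.
Proof.
move=> uI /choice[v vK]; exists v => // x; exact/uI/vK.
Qed.

Lemma isomorphic_sym A B : isomorphic A B -> isomorphic B A.
Proof.
case=> u [v uK vK].
suff hv (g : L) (x : Fin.t (arity g) -> B) :
    v (interp B g x) = interp A g (fun i => v (x i)).
  by exists (Hom hv); exists u.
rewrite -[RHS]uK hom_interp; congr (v (interp B g _)).
by apply: funext => i; rewrite vK.
Qed.

Lemma subalgebra_nonempty A (S : subuniverse A) : inhabited {a : A | S a}.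
Proof. by case: (sub_nonempty S) => a Sa; constructor; exists a. Qed.

Definition subalgebra A (S : subuniverse A) : algebra L :=
  @Algebra L {a : A | S a}
    (fun g x => exist S (interp A g (fun i => sval (x i)))
                  (sub_closed (fun i => svalP (x i))))
    (subalgebra_nonempty S).

Definition inclusion A (S : subuniverse A) : hom (subalgebra S) A :=
  @Hom L (subalgebra S) A sval (fun g x => erefl).

Lemma inclusion_inj A (S : subuniverse A) : injective (inclusion S).
Proof. by move=> [a Sa] [b Sb] /= ab; exact: eq_exist. Qed.

Section Image.
Variables (B A : algebra L) (u : hom B A).

Lemma image_nonempty : exists a, exists b, u b = a.
Proof. by case: (algebra_nonempty B) => b; exists (u b), b. Qed.

Lemma image_closed (g : L) (x : Fin.t (arity g) -> A) :
  (forall i, exists b, u b = x i) -> exists b, u b = interp A g x.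
Proof.
move=> /choice[y yx]; exists (interp B g y); rewrite hom_interp.
by congr interp; apply: funext.
Qed.

Definition image_subuniverse : subuniverse A :=
  @Subuniverse A (fun a => exists b, u b = a) image_nonempty image_closed.

Lemma image_isomorphic :
  injective u -> isomorphic B (subalgebra image_subuniverse).
Proof.
move=> uI.
pose v (b : B) : subalgebra image_subuniverse :=
  exist _ (u b) (ex_intro _ b erefl).
have hv (g : L) (x : Fin.t (arity g) -> B) :
    v (interp B g x) = interp (subalgebra _) g (fun i => v (x i)).
  by apply: eq_exist; rewrite hom_interp.
exists (Hom hv); apply: inj_surj_bij => [b c /(congr1 sval)/= /uI//|[a [b ab]]].
by exists b; exact: eq_exist.
Qed.

End Image.

Section ReducedProduct.
Variables (I : Type) (F : set_system I) (A : I -> algebra L).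

Definition red_rel (a b : forall i, A i) : Prop := F [set i | a i = b i].

(* The quotient is the type of equivalence classes of [red_rel]: the generic
   quotients of MathComp would raise the universe of the carrier. *)
Definition red_carrier : Type :=
  {c : (forall i, A i) -> Prop | exists a, c = red_rel a}.

Definition red_class (a : forall i, A i) : red_carrier :=
  exist _ (red_rel a) (ex_intro _ a erefl).

Definition red_repr (c : red_carrier) : forall i, A i := sval (cid (svalP c)).

Lemma red_nonempty : inhabited red_carrier.
Proof.
have pick i : A i by apply: inhabited_witness; exact: algebra_nonempty.
by constructor; exact: (red_class pick).
Qed.

Definition reduced_product : algebra L :=
  @Algebra L red_carrier
    (fun g x => red_class (fun i => interp (A i) g (fun k => red_repr (x k) i)))
    red_nonempty.

Lemma red_reprK (c : red_carrier) : red_class (red_repr c) = c.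
Proof.
by case: c => c hc; apply: eq_exist; rewrite /red_repr; case: cid.
Qed.

Context {FF : Filter F}.

Lemma red_rel_sym a b : red_rel a b -> red_rel b a.
Proof. by apply: (@filterS _ F) => i /= ->. Qed.

Lemma red_rel_trans a b c : red_rel a b -> red_rel b c -> red_rel a c.
Proof.
move=> ab bc; apply: (@filterS _ F _ _ _ _ (filterI ab bc)) => i [/= abi bci].
exact: etrans abi bci.
Qed.

Lemma red_classP a b : red_class a = red_class b <-> red_rel a b.
Proof.
split=> [/(congr1 sval)/= ab|ab].
  have -> : red_rel a b = red_rel b b by rewrite ab.
  by apply: (@filterS _ F _ setT) => //; exact: filterT.
apply: eq_exist; apply: funext => c; apply: propext; split.
  exact/red_rel_trans/red_rel_sym.
exact: red_rel_trans.
Qed.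

Lemma red_repr_class a : red_rel (red_repr (red_class a)) a.
Proof. by apply/red_classP; rewrite red_reprK. Qed.

Lemma interp_red_class (g : L) (x : Fin.t (arity g) -> forall i, A i) :
  interp reduced_product g (fun k => red_class (x k)) =
  red_class (fun i => interp (A i) g (fun k => x k i)).
Proof.
apply/red_classP.
apply: (@filterS _ F _ _ _ _ (filter_fin (F := F) (fun k => red_repr_class (x k)))).
move=> i /= xi; congr (interp (A i) g _).
by apply: funext => k; exact: xi.
Qed.

Lemma eval_red_class V (h : V -> forall i, A i) (t : term L V) :
  eval (A := reduced_product) (fun x => red_class (h x)) t =
  red_class (fun i => eval (fun x => h x i) t).
Proof.
elim: t => [//|g ts IH].
rewrite -[RHS](interp_red_class (fun k i => eval (fun x => h x i) (ts k))).
by congr (interp reduced_product g _); apply: funext => k; exact: IH.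
Qed.

Lemma hom_reduced_product B (u : forall i, hom B (A i)) :
  exists v : hom B reduced_product, forall b, v b = red_class (fun i => u i b).
Proof.
suff hv (g : L) (x : Fin.t (arity g) -> B) :
    red_class (fun i => u i (interp B g x)) =
    interp reduced_product g (fun k => red_class (fun i => u i (x k))).
  by exists (@Hom L B reduced_product (fun b => red_class (fun i => u i b)) hv).
rewrite interp_red_class; congr red_class.
by apply: functional_extensionality_dep => i; rewrite hom_interp.
Qed.

End ReducedProduct.

(* The filter [F] may be improper and the index type empty, so that every
   quasivariety contains the one-element algebras. *)
Record is_quasivariety (K : algebra L -> Prop) : Prop := IsQuasivariety {
  closed_iso : forall A B, isomorphic A B -> K A -> K B;
  closed_sub : forall A (S : subuniverse A), K A -> K (subalgebra S);
  closed_red : forall (I : Type) (F : set_system I) (A : I -> algebra L),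
    Filter F -> (forall i, K (A i)) -> K (reduced_product F A)
}.

Lemma dep_choice (I : Type) (T : I -> Type) (P : forall i, T i -> Prop) :
  (forall i, exists x, P i x) -> exists f, forall i, P i (f i).
Proof.
by move=> h; exists (fun i => sval (cid (h i))) => i; exact: (svalP (cid (h i))).
Qed.

Lemma closed_embedding (K : algebra L -> Prop) B A (u : hom B A) :
  is_quasivariety K -> injective u -> K A -> K B.
Proof.
move=> qK uI KA; apply: (closed_iso qK) (closed_sub qK _ KA).
exact/isomorphic_sym/(image_isomorphic uI).
Qed.

Record quasivariety := Quasivariety {
  qv_class :> algebra L -> Prop;
  qvP : is_quasivariety qv_class
}.

End Constructions.

Definition quasivariety_category (L : signature) (K : quasivariety L) : category :=
  @Category {A : algebra L | K A}
    (fun A B => hom (sval A) (sval B))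
    (fun A => id_hom (sval A))
    (fun A B C u v => comp_hom u v)
    (fun A B u => comp_homIl u)
    (fun A B u => comp_homIr u)
    (fun A B C D u v w => comp_homA u v w).
Coercion quasivariety_category : quasivariety >-> category.

Record Xi (L : signature) (K : quasivariety L) := MkXi {
  Xi_class :> algebra L -> Prop;
  Xi_qv : is_quasivariety Xi_class;
  Xi_sub : forall A, Xi_class A -> K A
}.

Lemma is_quasivariety_bigcap (L : signature) (J : Type) (P : J -> Prop)
    (K : J -> algebra L -> Prop) :
  (forall j, P j -> is_quasivariety (K j)) ->
  is_quasivariety (fun A => forall j, P j -> K j A).
Proof.
move=> qK; split=> /=.
- by move=> A B AB KA j Pj; apply: (closed_iso (qK j Pj) AB); exact: KA.
- by move=> A S KA j Pj; apply: (closed_sub (qK j Pj)); exact: KA.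
- by move=> I F A FF KA j Pj; apply: (closed_red (qK j Pj)) => i; exact: KA.
Qed.

Lemma is_quasivarietyI (L : signature) (P Q : algebra L -> Prop) :
  is_quasivariety P -> is_quasivariety Q ->
  is_quasivariety (fun A => P A /\ Q A).
Proof.
move=> qP qQ; split.
- by move=> A B AB [PA QA]; split; [exact: (closed_iso qP AB)|exact: (closed_iso qQ AB)].
- by move=> A S [PA QA]; split; [exact: (closed_sub qP)|exact: (closed_sub qQ)].
- move=> I F A FF PQA.
  by split; [apply: (closed_red qP)|apply: (closed_red qQ)] => i; case: (PQA i).
Qed.

Section XiLattice.
Variables (L : signature) (K : quasivariety L).
Implicit Types P Q R : Xi K.

Lemma Xi_ext P Q : (forall A, P A <-> Q A) -> P = Q.
Proof.
case: P Q => [P qP sP] [Q qQ sQ] /= PQ.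
have {}PQ : P = Q by apply: funext => A; exact/propext.
by subst Q; congr MkXi; exact: Prop_irrelevance.
Qed.

Definition Xi_le P Q : bool := `[< forall A, P A -> Q A >].

Lemma Xi_le_refl : reflexive Xi_le.
Proof. by move=> P; apply/asboolP. Qed.

Lemma Xi_le_anti : antisymmetric Xi_le.
Proof.
by move=> P Q /andP[/asboolP PQ /asboolP QP]; apply/Xi_ext => A; split; auto.
Qed.

Lemma Xi_le_trans : transitive Xi_le.
Proof.
by move=> Q P R /asboolP PQ /asboolP QR; apply/asboolP => A /PQ/QR.
Qed.

Definition Xi_meet P Q : Xi K :=
  MkXi (is_quasivarietyI (Xi_qv P) (Xi_qv Q)) (fun A h => Xi_sub (proj1 h)).

Definition Xi_join_class P Q (A : algebra L) : Prop :=
  forall R : Xi K, Xi_le P R /\ Xi_le Q R -> R A.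

Lemma Xi_join_qv P Q : is_quasivariety (Xi_join_class P Q).
Proof. by apply: is_quasivariety_bigcap => R _; exact: Xi_qv. Qed.

Lemma Xi_join_sub P Q A : Xi_join_class P Q A -> K A.
Proof.
move=> /(_ (MkXi (qvP K) (fun A KA => KA))); apply.
by split; apply/asboolP => B; exact: Xi_sub.
Qed.

Definition Xi_join P Q : Xi K := MkXi (@Xi_join_qv P Q) (@Xi_join_sub P Q).

Lemma Xi_meetP P Q R : Xi_le P (Xi_meet Q R) = Xi_le P Q && Xi_le P R.
Proof.
apply/asboolP/andP => [h|[/asboolP PQ /asboolP PR]].
  by split; apply/asboolP => A /h[].
by move=> A PA; split; [exact: PQ|exact: PR].
Qed.

Lemma Xi_joinP P Q R : Xi_le (Xi_join P Q) R = Xi_le P R && Xi_le Q R.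
Proof.
apply/asboolP/andP => [h|[PR QR] A]; last by apply.
by split; apply/asboolP => A hA; apply: h => S [/asboolP PS /asboolP QS]; auto.
Qed.

HB.instance Definition _ := gen_eqMixin (Xi K).
HB.instance Definition _ := gen_choiceMixin (Xi K).
HB.instance Definition _ := Order.Le_isPOrder.Build Order.default_display (Xi K)
  Xi_le_refl Xi_le_anti Xi_le_trans.
HB.instance Definition _ := Order.POrder_MeetJoin_isLattice.Build
  Order.default_display (Xi K) Xi_meetP Xi_joinP.

End XiLattice.

Record infinite_type := InfiniteType {
  infinite_sort :> Type;
  infinite_sortP : infinite_set [set: infinite_sort]
}.

Lemma infinite_nat_inj (V : infinite_type) : exists j : nat -> V, injective j.
Proof.
have /infiniteP/card_leP[j] := @infinite_sortP V.
exists (fun n => sval (j (exist _ n (mem_set I)))) => m n mn.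
have /(congr1 sval)// : exist (fun x => x \in [set: nat]) m (mem_set I) =
  exist (fun x => x \in [set: nat]) n (mem_set I).
apply: (@inj _ _ setT j); rewrite ?inE//.
exact: val_inj.
Qed.

Section Implications.
Variables (L : signature) (K : algebra L -> Prop).
Hypothesis qK : is_quasivariety K.
Variables (V : infinite_type) (B : algebra L).
Hypothesis BK : forall (Phi : set (equation L V)) (e : equation L V),
  consequence K Phi e -> forall h : V -> B,
  (forall e', Phi e' -> satisfies h e') -> satisfies h e.

Let fact : Type := {g : L & Fin.t (arity g) -> B}.
Let preserves (A : algebra L) (h : B -> A) (d : fact) : Prop :=
  h (interp B (tag d) (tagged d)) = interp A (tag d) (fun i => h (tagged d i)).

Let finite_code (l : seq B) : exists (v : B -> V) (k : V -> B),
  forall b, List.In b l -> k (v b) = b.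
Proof.
have b0 : B by apply: inhabited_witness; exact: algebra_nonempty.
have [j jI] := infinite_nat_inj V.
have /choice[n nP] : forall b, exists n, List.In b l -> nth b0 l n = b.
  move=> b; elim: l => [|c l [n IH]]; first by exists 0.
  have [bc|bc] := pselect (c = b); first by exists 0.
  by exists n.+1 => -[//|/IH].
have /choice[k kP] : forall x, exists b, forall m, j m = x -> b = nth b0 l m.
  move=> x; have [[m mx]|xj] := pselect (exists m, j m = x).
    by exists (nth b0 l m) => p; rewrite -mx => /jI ->.
  by exists b0 => m mx; case: xj; exists m.
by exists (j \o n), k => b bl; rewrite (kP _ (n b) erefl) nP.
Qed.

Let finite_separation (s : seq fact) (b c : B) : b <> c ->
  exists (A : algebra L) (h : B -> A),
    [/\ K A, h b <> h c & forall d, List.In d s -> preserves h d].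
Proof.
move=> bc.
pose l := b :: c :: List.flat_map (fun d : fact =>
  interp B (tag d) (tagged d) :: [seq tagged d i | i <- fin_enum (arity (tag d))]) s.
have [v [k kv]] := finite_code l.
have l_val (d : fact) : List.In d s -> List.In (interp B (tag d) (tagged d)) l.
  by move=> ds; right; right; apply/List.in_flat_map; exists d; split => //; left.
have l_arg (d : fact) i : List.In d s -> List.In (tagged d i) l.
  move=> ds; right; right; apply/List.in_flat_map; exists d; split => //; right.
  exact/List.in_map/mem_fin_enum.
apply: contrapT => noA.
pose Phi : set (equation L V) := [set e | exists2 d : fact, List.In d s &
  e = (Var (v (interp B (tag d) (tagged d))),
       App (tag d) (fun i => Var (v (tagged d i))))].
have /BK/(_ k) : consequence K Phi (Var (v b), Var (v c)).
  move=> A KA h hPhi; rewrite /satisfies /=; apply: contrapT => hbc.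
  apply: noA; exists A, (h \o v); split=> // d ds.
  exact: (hPhi _ (ex_intro2 _ _ d ds erefl)).
rewrite /satisfies /= !kv; [|by right; left|by left].
move=> h; apply/bc/h => _ [d ds ->] /=.
rewrite kv; last exact: l_val.
by congr interp; apply: funext => i; rewrite kv//; exact: l_arg.
Qed.

Let separation (b c : B) : b <> c ->
  exists (A : algebra L) (h : hom B A), K A /\ h b <> h c.
Proof.
move=> bc.
pose P (s : seq fact) (Ah : {A : algebra L & B -> A}) := let h := tagged Ah in
  [/\ K (tag Ah), h b <> h c & forall d, List.In d s -> preserves h d].
have /choice[Ah AhP] : forall s, exists Ah, P s Ah.
  by move=> s; have [A [h hP]] := finite_separation s bc; exists (existT _ A h).
pose F : set_system (seq fact) :=
  [set Q | exists s0, forall s, List.incl s0 s -> Q s].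
have FF : Filter F.
  split; first by exists [::].
    move=> Q R [s Qs] [t Rt]; exists (s ++ t)%SEQ => w stw; split.
      by apply: Qs => x xs; apply: stw; apply/List.in_app_iff; left.
    by apply: Rt => x xs; apply: stw; apply/List.in_app_iff; right.
  by move=> Q R QR [s Qs]; exists s => t /Qs/QR.
pose A s := tag (Ah s).
pose h x : reduced_product F A :=
  red_class F (A := A) (fun s => tagged (Ah s) x).
have hh (g : L) (x : Fin.t (arity g) -> B) :
    h (interp B g x) = interp (reduced_product F A) g (fun i => h (x i)).
  rewrite /h interp_red_class; apply/red_classP.
  exists [:: (existT _ g x : fact)] => s gs /=.
  by case: (AhP s) => _ _ /(_ (existT _ g x)); apply; apply: gs; left.
exists (reduced_product F A), (Hom hh); split.
  by apply: (closed_red qK) => s; case: (AhP s).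
move=> /= /red_classP[s /(_ s)] sbc.
by case: (AhP s) => _ + _; apply; exact: sbc.
Qed.

Lemma quasivariety_implications : K B.
Proof.
pose I := {bc : B * B | bc.1 <> bc.2}.
have /choice[Ah AhP] : forall i : I, exists Ah : {A : algebra L & hom B A},
    K (tag Ah) /\ tagged Ah (sval i).1 <> tagged Ah (sval i).2.
  by move=> [[b c] /= /separation[A [h hP]]]; exists (existT _ A h).
pose F : set_system I := globally setT.
have [v vE] := hom_reduced_product (F := F) (fun i => tagged (Ah i)).
apply: (closed_embedding qK (u := v)).
  move=> b c; rewrite !vE => /red_classP vbc; apply: contrapT => bc.
  have [_] := AhP (exist _ (b, c) bc); apply.
  exact: (vbc (exist _ (b, c) bc) Logic.I).
by apply: (closed_red qK) => i; case: (AhP i).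
Qed.

End Implications.

Section Translation.
Variables (LX LY : signature).

Section Zstar.
Variables (zeta : forall g : LX, term LY (Fin.t (arity g))) (sel : term LY (Fin.t 1)).

(* [sel] is a unary term and [apply_sel t] is the term sel(t). *)
Definition apply_sel V (t : term LY V) : term LY V := term_subst (fun=> t) sel.

Fixpoint zstar V (t : term LX V) : term LY V :=
  match t with
  | Var x => apply_sel (Var x)
  | App g ts => term_subst (fun i => zstar (ts i)) (zeta g)
  end.

Definition zstar_eqn V (e : equation LX V) : equation LY V :=
  (zstar e.1, zstar e.2).

Definition sel_eqns V : set (equation LY V) :=
  [set (apply_sel (Var x), Var x) | x in [set: V]].

End Zstar.
Arguments sel_eqns sel V : clear implicits.

Record selective_translation (V : infinite_type)
    (X : quasivariety LX) (Y : quasivariety LY) := SelectiveTranslation {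
  zeta : forall g : LX, term LY (Fin.t (arity g));
  sel : term LY (Fin.t 1);
  sel_idem : consequence Y set0
    (apply_sel sel (apply_sel sel (Var Fin.F1)), apply_sel sel (Var Fin.F1 : term LY (Fin.t 1)));
  zstar_consequence : forall (Phi : set (equation LX V)) (e : equation LX V),
    consequence X Phi e ->
    consequence Y ([set zstar_eqn zeta sel e' | e' in Phi] `|` sel_eqns sel V)
      (zstar_eqn zeta sel e);
  sel_zeta : forall g : LX,
    consequence Y (sel_eqns sel (Fin.t (arity g)))
      (apply_sel sel (zeta g), zeta g)
}.

Variables (V : infinite_type) (X : quasivariety LX) (Y : quasivariety LY).
Variable tr : selective_translation V X Y.

Definition sel_op (A : algebra LY) (a : A) : A := eval (fun=> a) (sel tr).

Definition sel_fixed (A : algebra LY) : set A := [set a | sel_op a = a].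

Lemma eval_apply_sel (A : algebra LY) W (h : W -> A) (t : term LY W) :
  eval h (apply_sel (sel tr) t) = sel_op (eval h t).
Proof. by rewrite /apply_sel eval_subst. Qed.

Lemma sel_opK (A : algebra LY) (a : A) : Y A -> sel_fixed (sel_op a).
Proof.
move=> YA; have := @sel_idem _ _ _ tr A YA (fun=> a).
by rewrite /satisfies /= !eval_apply_sel /=; apply.
Qed.

Lemma hom_sel_op (A B : algebra LY) (u : hom A B) a : u (sel_op a) = sel_op (u a).
Proof. by rewrite /sel_op hom_eval. Qed.

Section Theta.
Variables (A : algebra LY) (YA : Y A).

Lemma theta_closed (g : LX) (x : Fin.t (arity g) -> {a : A | sel_fixed a}) :
  sel_fixed (eval (fun i => sval (x i)) (zeta tr g)).
Proof.
have := @sel_zeta _ _ _ tr g A YA (fun i => sval (x i)).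
rewrite /satisfies /= eval_apply_sel; apply=> _ [i _ <-].
by rewrite /= eval_apply_sel; exact: (svalP (x i)).
Qed.

Lemma theta_nonempty : inhabited {a : A | sel_fixed a}.
Proof.
by case: (algebra_nonempty A) => a; constructor; exists (sel_op a); exact: sel_opK.
Qed.

Definition theta_algebra : algebra LX :=
  @Algebra LX {a : A | sel_fixed a}
    (fun g x => exist _ (eval (fun i => sval (x i)) (zeta tr g)) (theta_closed x))
    theta_nonempty.

Lemma eval_zstar W (h : W -> theta_algebra) (t : term LX W) :
  eval (fun x => sval (h x)) (zstar (zeta tr) (sel tr) t) = sval (eval h t).
Proof.
elim: t => /= [x|g ts IH]; first by rewrite eval_apply_sel; exact: (svalP (h x)).
by rewrite eval_subst; apply: eq_eval => i; exact: IH.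
Qed.

Lemma theta_in_X : X theta_algebra.
Proof.
apply: (quasivariety_implications (qvP X) (V := V)) => Phi e Phie h hPhi.
have := @zstar_consequence _ _ _ tr _ _ Phie _ YA (fun x => sval (h x)).
rewrite /satisfies /= !eval_zstar => he.
suff /he : forall e', ([set zstar_eqn (zeta tr) (sel tr) e'0 | e'0 in Phi]
    `|` sel_eqns (sel tr) V) e' -> satisfies (fun x => sval (h x)) e'.
  by case: (eval h e.1) (eval h e.2) => [a fa] [b fb] /= ab; exact: eq_exist.
move=> _ [[e' Phie' <-]|[x _ <-]]; rewrite /satisfies /=.
  by rewrite !eval_zstar; congr sval; exact: hPhi.
by rewrite eval_apply_sel; exact: (svalP (h x)).
Qed.

End Theta.

Lemma theta_fmap_fix (A B : algebra LY) (u : hom A B) (a : {a : A | sel_fixed a}) :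
  sel_fixed (u (sval a)).
Proof. by rewrite /sel_fixed /= -hom_sel_op; congr (u _); exact: (svalP a). Qed.

Definition theta_fun (A B : algebra LY) (YA : Y A) (YB : Y B) (u : hom A B) :
    theta_algebra YA -> theta_algebra YB :=
  fun a => exist _ (u (sval a)) (theta_fmap_fix u a).

Lemma theta_fun_interp (A B : algebra LY) (YA : Y A) (YB : Y B) (u : hom A B)
    (g : LX) (x : Fin.t (arity g) -> theta_algebra YA) :
  theta_fun YB u (interp (theta_algebra YA) g x) =
  interp (theta_algebra YB) g (fun i => theta_fun YB u (x i)).
Proof. by apply: eq_exist; rewrite /= hom_eval. Qed.

Definition theta_obj (A : Y) : X :=
  exist _ (theta_algebra (proj2_sig A)) (theta_in_X (proj2_sig A)).

Definition theta_hom (A B : Y) (u : mor A B) : mor (theta_obj A) (theta_obj B) :=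
  Hom (@theta_fun_interp _ _ (proj2_sig A) (proj2_sig B) u).

Lemma theta_hom_id (A : Y) : theta_hom (idm A) = idm (theta_obj A).
Proof. by apply: hom_ext => -[a fa]; exact: eq_exist. Qed.

Lemma theta_hom_comp (A B C : Y) (u : mor B C) (v : mor A B) :
  theta_hom (mor_comp u v) = mor_comp (theta_hom u) (theta_hom v).
Proof. by apply: hom_ext => a; exact: eq_exist. Qed.

Definition theta : functor Y X :=
  @Functor Y X theta_obj theta_hom theta_hom_id theta_hom_comp.

Definition strongly_selective_for (F : functor X Y) (adj : adjunction F theta) :
    Prop :=
  forall A : X, is_iso (unit_ adj A).

Definition sober_for (F : functor X Y) (adj : adjunction F theta) : Prop :=
  [/\ strongly_selective_for adj,
      forall A : Y, injective (counit_ adj A : hom _ _)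
    & forall (A B : X) (u : mor A B),
        injective (u : hom _ _) -> injective (fmap F u : hom _ _)].

(* Left adjoints are unique up to a natural isomorphism compatible with units
   and counits, so the choice of [F] is immaterial. *)
Definition sober : Prop :=
  exists (F : functor X Y) (adj : adjunction F theta), sober_for adj.

Definition sub_same_fix (A : algebra LY) (S : subuniverse A) : Prop :=
  [set sval b | b in @sel_fixed (subalgebra S)] = @sel_fixed A.

Definition up_class (K : algebra LY -> Prop) (A : algebra LY) : Prop :=
  Y A /\ exists S : subuniverse A, K (subalgebra S) /\ sub_same_fix S.

Lemma sub_same_fixP (A : algebra LY) (S : subuniverse A) :
  sub_same_fix S <-> forall a, sel_fixed a -> S a.
Proof.
have sv (b : subalgebra S) : sval (sel_op b) = sel_op (sval b).
  exact: (hom_sel_op (inclusion S)).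
split=> [SA a|SA].
  by rewrite -[sel_fixed a]/(@sel_fixed A a) -SA => -[[b Sb] _ <-].
apply/seteqP; split=> [_ [b fb <-]|a fa]; first by rewrite /sel_fixed /= -sv fb.
exists (exist _ a (SA a fa)) => //.
by apply: (@inclusion_inj _ _ S); rewrite hom_sel_op.
Qed.

Lemma up_intro (K : algebra LY -> Prop) (B A : algebra LY) (m : hom B A) :
  is_quasivariety K -> Y A -> K B -> injective m ->
  (forall a, sel_fixed a -> exists b, m b = a) -> up_class K A.
Proof.
move=> qK YA KB mI mf; split=> //; exists (image_subuniverse m); split.
  exact: (closed_iso qK (image_isomorphic mI)).
exact/sub_same_fixP.
Qed.

Lemma up_elim (K : algebra LY -> Prop) (A : algebra LY) : up_class K A ->
  exists (B : algebra LY) (m : hom B A),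
    [/\ K B, injective m & forall a, sel_fixed a -> exists b, m b = a].
Proof.
move=> [_ [S [KS /sub_same_fixP SA]]]; exists (subalgebra S), (inclusion S).
split=> //; first exact: inclusion_inj.
by move=> a /SA Sa; exists (exist _ a Sa).
Qed.

Lemma up_mono (K K' : algebra LY -> Prop) (A : algebra LY) :
  (forall B, K B -> K' B) -> up_class K A -> up_class K' A.
Proof. by move=> KK' [YA [S [KS SA]]]; split=> //; exists S; split; auto. Qed.

Lemma up_incr (K : algebra LY -> Prop) (A : algebra LY) :
  is_quasivariety K -> Y A -> K A -> up_class K A.
Proof.
by move=> qK YA KA; apply: (up_intro (m := id_hom A)) => // a _; exists a.
Qed.

Lemma up_up (K : algebra LY -> Prop) (A : algebra LY) :
  is_quasivariety K -> up_class (up_class K) A -> up_class K A.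
Proof.
move=> qK uuA; have [B [m [/up_elim[C [n [KC nI nf]]] mI mf]]] := up_elim uuA.
apply: (up_intro (m := comp_hom m n) qK uuA.1 KC); first exact: inj_comp.
move=> a fa; have [b ba] := mf a fa.
have /nf[c cb] : sel_fixed b by apply: mI; rewrite hom_sel_op ba.
by exists c; rewrite /= cb.
Qed.

Lemma up_quasivariety (K : algebra LY -> Prop) :
  is_quasivariety K -> is_quasivariety (up_class K).
Proof.
move=> qK; split.
- move=> A A' [u [u' uK u'K]] uA; have [B [m [KB mI mf]]] := up_elim uA.
  apply: (up_intro (m := comp_hom u m) qK _ KB).
  + by apply: (closed_iso (qvP Y) _ uA.1); exists u; exists u'.
  + by apply: inj_comp => //; exact: can_inj uK.
  move=> a' fa'; have /mf[b ba] : sel_fixed (u' a').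
    by apply: (can_inj uK); rewrite hom_sel_op u'K.
  by exists b; rewrite /= ba u'K.
- move=> A S uA; have [B [m [KB mI mf]]] := up_elim uA.
  have YS : Y (subalgebra S) by exact: (closed_sub (qvP Y) _ uA.1).
  have fixS (s : subalgebra S) : sel_fixed s -> sel_fixed (sval s).
    by move=> fs; rewrite /sel_fixed /= -(hom_sel_op (inclusion S)) fs.
  have T0 : exists b, S (m b).
    have [s] := theta_nonempty YS.
    by have [b bs] := mf _ (fixS _ (svalP s)); exists b; rewrite bs; exact: (svalP (sval s)).
  have TC (g : LY) (x : Fin.t (arity g) -> B) :
      (forall i, S (m (x i))) -> S (m (interp B g x)).
    by move=> Sx; rewrite hom_interp; exact: sub_closed.
  pose T := @Subuniverse _ B (fun b => S (m b)) T0 TC.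
  pose n (b : subalgebra T) : subalgebra S := exist _ (m (sval b)) (svalP b).
  have hn (g : LY) (x : Fin.t (arity g) -> subalgebra T) :
      n (interp (subalgebra T) g x) = interp (subalgebra S) g (fun i => n (x i)).
    by apply: eq_exist; rewrite /= hom_interp.
  apply: (up_intro (m := Hom hn) qK YS (closed_sub qK T KB)).
    move=> b c /(congr1 sval)/= /mI bc.
    exact: (@inclusion_inj _ _ T).
  move=> s /fixS/mf[b bs]; have Sb : T b by rewrite /= bs; exact: (svalP s).
  by exists (exist _ b Sb); exact: (@inclusion_inj _ _ S).
- move=> I F A FF uA.
  have /dep_choice[Bm BmP] : forall i, exists Bm : {B : algebra LY & hom B (A i)},
      [/\ K (tag Bm), injective (tagged Bm)
        & forall a, sel_fixed a -> exists b, tagged Bm b = a].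
    by move=> i; have [B [m hm]] := up_elim (uA i); exists (existT _ B m).
  pose B i := tag (Bm i); pose m i : hom (B i) (A i) := tagged (Bm i).
  pose n (c : reduced_product F B) : reduced_product F A :=
    red_class F (fun i => m i (red_repr c i)).
  have nE b : n (red_class F b) = red_class F (fun i => m i (b i)).
    apply/red_classP; have := red_repr_class (FF := FF) b.
    by apply: (@filterS _ F) => i /= ->.
  have hn (g : LY) (x : Fin.t (arity g) -> reduced_product F B) :
      n (interp (reduced_product F B) g x) =
      interp (reduced_product F A) g (fun k => n (x k)).
    rewrite [interp (reduced_product F B) g x]/= nE interp_red_class.
    by congr red_class; apply: functional_extensionality_dep => i; rewrite hom_interp.
  apply: (up_intro (m := Hom hn) (B := reduced_product F B)) => //.
  + by apply: (closed_red (qvP Y)) => i; case: (uA i).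
  + by apply: (closed_red qK) => i; case: (BmP i).
  + move=> c d; rewrite -(red_reprK c) -(red_reprK d) /= !nE => /red_classP cd.
    apply/red_classP; apply: (@filterS _ F _ _ _ _ cd) => i /=.
    by case: (BmP i) => _ + _; apply.
  move=> c fc; pose a i := red_repr c i.
  have /dep_choice[b bP] : forall i, exists b : B i, m i b = sel_op (a i).
    by move=> i; case: (BmP i) => _ _; apply; apply: sel_opK; case: (uA i).
  exists (red_class F b); rewrite /= nE -[RHS]fc -(red_reprK c).
  rewrite /sel_op eval_red_class; congr red_class.
  by apply: functional_extensionality_dep => i; rewrite bP.
Qed.

Record Xi_f := MkXi_f {
  Xi_f_class :> algebra LY -> Prop;
  Xi_f_up : exists K : Xi Y, forall A, Xi_f_class A <-> up_class K A
}.
Implicit Types P Q R : Xi_f.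

Lemma up_closed_Xi_f (K : algebra LY -> Prop) :
  is_quasivariety K -> (forall A, K A -> Y A) -> (forall A, up_class K A -> K A) ->
  exists K' : Xi Y, forall A, K A <-> up_class K' A.
Proof.
move=> qK KY uK; exists (MkXi qK KY) => A; split; last exact: uK.
by move=> KA; apply: up_incr => //; exact: KY.
Qed.

Lemma Xi_f_qv P : is_quasivariety P.
Proof.
case: P => P /= [K PK]; have -> : P = up_class K by apply: funext => A; exact/propext.
exact/up_quasivariety/Xi_qv.
Qed.

Lemma Xi_f_sub P A : P A -> Y A.
Proof. by case: P => P /= [K PK] /PK[]. Qed.

Lemma Xi_f_up_closed P A : up_class P A -> P A.
Proof.
case: P => P /= [K PK] uP; apply/PK/up_up; first exact: Xi_qv.
by apply: up_mono uP => B /PK.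
Qed.

Lemma Xi_f_ext P Q : (forall A, P A <-> Q A) -> P = Q.
Proof.
case: P Q => [P uP] [Q uQ] /= PQ.
have {}PQ : P = Q by apply: funext => A; exact/propext.
by subst Q; congr MkXi_f; exact: Prop_irrelevance.
Qed.

Definition Xi_f_le P Q : bool := `[< forall A, P A -> Q A >].

Lemma Xi_f_le_refl : reflexive Xi_f_le.
Proof. by move=> P; apply/asboolP. Qed.

Lemma Xi_f_le_anti : antisymmetric Xi_f_le.
Proof.
by move=> P Q /andP[/asboolP PQ /asboolP QP]; apply/Xi_f_ext => A; split; auto.
Qed.

Lemma Xi_f_le_trans : transitive Xi_f_le.
Proof.
by move=> Q P R /asboolP PQ /asboolP QR; apply/asboolP => A /PQ/QR.
Qed.

Lemma Xi_f_meet_up P Q :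
  exists K : Xi Y, forall A, P A /\ Q A <-> up_class K A.
Proof.
apply: (@up_closed_Xi_f (fun A => P A /\ Q A)).
- by apply: is_quasivarietyI; exact: Xi_f_qv.
- by move=> A [/Xi_f_sub].
- move=> A uA; split; apply: Xi_f_up_closed.
    by apply: up_mono uA => B [].
  by apply: up_mono uA => B [].
Qed.

Definition Xi_f_meet P Q : Xi_f := MkXi_f (Xi_f_meet_up P Q).

Definition Xi_f_join_class P Q (A : algebra LY) : Prop :=
  Y A /\ forall R : Xi_f, Xi_f_le P R /\ Xi_f_le Q R -> R A.

Lemma Xi_f_join_up P Q :
  exists K : Xi Y, forall A, Xi_f_join_class P Q A <-> up_class K A.
Proof.
apply: up_closed_Xi_f.
- apply: is_quasivarietyI; first exact: qvP.
  by apply: is_quasivariety_bigcap => R _; exact: Xi_f_qv.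
- by move=> A [].
- move=> A uA; split; first exact: uA.1.
  move=> R PQR; apply: Xi_f_up_closed.
  by apply: up_mono uA => B [_]; apply.
Qed.

Definition Xi_f_join P Q : Xi_f := MkXi_f (Xi_f_join_up P Q).

Lemma Xi_f_meetP P Q R : Xi_f_le P (Xi_f_meet Q R) = Xi_f_le P Q && Xi_f_le P R.
Proof.
apply/asboolP/andP => [h|[/asboolP PQ /asboolP PR]].
  by split; apply/asboolP => A /h[].
by move=> A PA; split; [exact: PQ|exact: PR].
Qed.

Lemma Xi_f_joinP P Q R : Xi_f_le (Xi_f_join P Q) R = Xi_f_le P R && Xi_f_le Q R.
Proof.
apply/asboolP/andP => [h|[PR QR] A [_]]; last by apply.
split; apply/asboolP => A hA; apply: h; split; try exact: Xi_f_sub hA.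
  by move=> S [/asboolP PS _]; exact: PS.
by move=> S [_ /asboolP QS]; exact: QS.
Qed.

HB.instance Definition _ := gen_eqMixin Xi_f.
HB.instance Definition _ := gen_choiceMixin Xi_f.
HB.instance Definition _ := Order.Le_isPOrder.Build Order.default_display Xi_f
  Xi_f_le_refl Xi_f_le_anti Xi_f_le_trans.
HB.instance Definition _ := Order.POrder_MeetJoin_isLattice.Build
  Order.default_display Xi_f Xi_f_meetP Xi_f_joinP.

Definition tau_class (K : Xi X) (A : algebra LY) : Prop :=
  exists YA : Y A, K (sval (theta (exist _ A YA))).

End Translation.

(* Main.v *)
Require Import Defs.
From mathcomp Require Import all_boot all_order.
From mathcomp Require Import boolp classical_sets filter.

(** The inverse of [tau] sends an [f]-quasivariety [P] of [Y] to the class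
    [preimage_class P] of all algebras of [X] embeddable in some [theta B] with
    [B] in [P].

    Both directions rest on the counit [F (theta A) -> A]. It is injective by
    sobriety, and by a triangle identity its image contains every point of [A]
    fixed by the selector. So if [theta A] embeds in [theta B] with [B] in [P],
    then [F (theta A)] embeds in [F (theta B)], hence in [B], hence lies in [P];
    and [A], which has a copy of [F (theta A)] as a subalgebra with the same
    fixed points, lies in [P] because [P] is closed under [up_class]. This is
    [theta_embedding_reflects], and it says that [tau] maps [preimage_class P]
    to [P]. In the other direction, every [A] in [X] is isomorphic to
    [theta (F A)], the unit being invertible; so [tau K] determines [K], and
    even the inclusions between the classes [tau K] come from inclusions
    between the [K].

    That [tau K] and [preimage_class P] are quasivarieties holds because [theta]
    preserves embeddings and commutes with reduced products
    ([theta_reduced_product]); [tau K] is closed under [up_class] because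
    [theta A] depends, up to isomorphism, only on a subalgebra of [A] with all
    the fixed points. A bijection that preserves and reflects the order respects
    meets and joins. *)

Set Implicit Arguments.
Unset Strict Implicit.
Unset Printing Implicit Defensive.

Local Open Scope classical_set_scope.

Section OrderIsomorphism.
Import Order.Theory.
Variables (d d' : Order.disp_t) (T : latticeType d) (T' : latticeType d').
Variables (f : T -> T') (g : T' -> T).
Hypotheses (f_le : {mono f : x y / (x <= y)%O}) (gK : cancel g f).

Lemma order_iso_meet : Order.meet_morphism f.
Proof.
move=> x y; apply: le_anti; rewrite lexI !f_le leIl leIr /=.
by rewrite -[X in (X <= _)%O]gK f_le lexI -!f_le gK leIl leIr.
Qed.

Lemma order_iso_join : Order.join_morphism f.
Proof.
move=> x y; apply: le_anti; rewrite leUx !f_le leUl leUr /= andbT.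
by rewrite -[X in (_ <= X)%O]gK f_le leUx -!f_le gK leUl leUr.
Qed.

End OrderIsomorphism.

Section Tau.
Variables (LX LY : signature) (V : infinite_type).
Variables (X : quasivariety LX) (Y : quasivariety LY).
Variable tr : selective_translation V X Y.

Lemma theta_hom_inj (A B : Y) (u : mor A B) :
  injective (u : hom _ _) -> injective (theta_hom tr u : hom _ _).
Proof. by move=> uI [a fa] [b fb] /(congr1 sval)/= /uI ab; exact: eq_exist. Qed.

Lemma theta_isomorphic (A B : Y) (u : mor A B) :
  injective (u : hom _ _) ->
  (forall b, sel_fixed tr b -> exists a, (u : hom _ _) a = b) ->
  isomorphic (sval (theta tr A)) (sval (theta tr B)).
Proof.
move=> uI us; exists (theta_hom tr u); apply: inj_surj_bij; first exact: theta_hom_inj.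
move=> [b fb]; have [a ab] := us b fb.
have fa : sel_fixed tr a by apply: uI; rewrite hom_sel_op ab.
by exists (exist _ a fa); exact: eq_exist.
Qed.

Section ReducedProduct.
Variables (I : Type) (F : set_system I) (FF : Filter F).
Variables (A : I -> algebra LX) (B : I -> Y).
Variable u : forall i, hom (A i) (sval (theta tr (B i))).

Lemma closed_red_obj : Y (reduced_product F (fun i => sval (B i))).
Proof. by apply: (closed_red (qvP Y)) => i; exact: svalP. Qed.

Definition red_obj : Y := exist _ _ closed_red_obj.

Lemma theta_red_fixed (c : forall i, A i) :
  @sel_fixed _ _ _ _ _ tr (sval red_obj) (red_class F (fun i => sval (u i (c i)))).
Proof.
rewrite /sel_fixed /= /sel_op eval_red_class; congr red_class.
by apply: functional_extensionality_dep => i; exact: (svalP (u i (c i))).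
Qed.

(** The comparison between the reduced product of the [theta (B i)] and [theta]
    of the reduced product of the [B i], precomposed with arbitrary [u i] so
    that it serves both for families of isomorphisms and for families of
    embeddings. It is onto when the [u i] are, because a class fixed by the
    selector is represented by the family obtained by applying the selector in
    each coordinate. *)
Lemma theta_reduced_product :
  exists w : hom (reduced_product F A) (sval (theta tr red_obj)),
    ((forall i, injective (u i)) -> injective w) /\
    ((forall i b, exists a, u i a = b) -> forall b, exists a, w a = b).
Proof.
pose w (c : reduced_product F A) : sval (theta tr red_obj) :=
  exist _ _ (theta_red_fixed (red_repr c)).
have wE a : sval (w (red_class F a)) = red_class F (fun i => sval (u i (a i))).
  apply/red_classP; have := red_repr_class (FF := FF) a.
  by apply: (@filterS _ F) => i /= ->.
have hw (g : LX) (x : Fin.t (arity g) -> reduced_product F A) :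
    w (interp (reduced_product F A) g x) =
    interp (sval (theta tr red_obj)) g (fun k => w (x k)).
  apply: eq_exist.
  apply: etrans (wE (fun i => interp (A i) g (fun k => red_repr (x k) i))) _.
  rewrite eval_red_class; congr red_class.
  by apply: functional_extensionality_dep => i; rewrite hom_interp.
exists (Hom hw); split=> [uI c d|us [c fc]].
  rewrite -(red_reprK c) -(red_reprK d) => /(congr1 sval).
  rewrite !wE => /red_classP cd.
  apply/red_classP; apply: (@filterS _ F _ _ _ _ cd) => i /= cdi.
  apply: uI; move: (u i _) (u i _) cdi => [a fa] [b fb] /= ab.
  exact: eq_exist.
pose s i : sval (theta tr (B i)) :=
  exist _ _ (sel_opK tr (red_repr c i) (svalP (B i))).
have /dep_choice[a aE] : forall i, exists a, u i a = s i by move=> i; exact: us.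
exists (red_class F a); apply: eq_exist; apply: etrans (wE a) _.
rewrite -[RHS]fc -(red_reprK c) /sel_op eval_red_class.
by congr red_class; apply: functional_extensionality_dep => i; rewrite aE.
Qed.

End ReducedProduct.

Lemma tau_classE (K : Xi X) (A : Y) :
  tau_class tr K (sval A) <-> K (sval (theta tr A)).
Proof.
case: A => A YA; split=> [[YA']|KA]; last by exists YA.
by rewrite (Prop_irrelevance YA' YA).
Qed.

Lemma tau_class_sub (K : Xi X) A : tau_class tr K A -> Y A.
Proof. by case. Qed.

Lemma tau_class_embedding (K : Xi X) (A B : Y) (u : mor A B) :
  injective (u : hom _ _) -> tau_class tr K (sval B) -> tau_class tr K (sval A).
Proof.
move=> uI /tau_classE KB; apply/tau_classE.
exact: (closed_embedding (Xi_qv K) (theta_hom_inj uI)).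
Qed.

Lemma tau_class_quasivariety (K : Xi X) : is_quasivariety (tau_class tr K).
Proof.
split.
- move=> A B AB tA; have YA := tau_class_sub tA.
  have YB : Y B := closed_iso (qvP Y) AB YA.
  have [u /bij_inj uI] := isomorphic_sym AB.
  exact: (@tau_class_embedding K (exist _ B YB) (exist _ A YA) u).
- move=> A S tA; have YA := tau_class_sub tA.
  have YS : Y (subalgebra S) := closed_sub (qvP Y) S YA.
  apply: (@tau_class_embedding K (exist _ _ YS) (exist _ A YA) (inclusion S)) => //.
  exact: inclusion_inj.
- move=> I F A FF tA.
  pose B i : Y := exist _ (A i) (tau_class_sub (tA i)).
  apply/(tau_classE K (red_obj FF B)).
  have [w [wI ws]] := theta_reduced_product FF (fun i => id_hom (sval (theta tr (B i)))).
  apply: (closed_iso (Xi_qv K) (A := reduced_product F (fun i => sval (theta tr (B i))))).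
    exists w; apply: inj_surj_bij; first by apply: wI => i x y; apply.
    by apply: ws => i b; exists b.
  by apply: (closed_red (Xi_qv K)) => i; apply/tau_classE; exact: tA.
Qed.

Lemma tau_class_up_closed (K : Xi X) A :
  up_class tr (tau_class tr K) A -> tau_class tr K A.
Proof.
move=> uA; have [B [m [tB mI ms]]] := up_elim uA.
have YB := tau_class_sub tB; apply/(tau_classE K (exist _ A uA.1)).
apply: (closed_iso (Xi_qv K)); last exact/(tau_classE K (exist _ B YB)).
exact: (theta_isomorphic (A := exist _ B YB) (B := exist _ A uA.1) (u := m)).
Qed.

Definition tau (K : Xi X) : Xi_f tr :=
  MkXi_f (up_closed_Xi_f (tau_class_quasivariety K) (@tau_class_sub K)
            (@tau_class_up_closed K)).

(** With embeddings in place of isomorphisms, closure under subalgebras is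
    immediate; sobriety makes the two choices define the same class. *)
Definition preimage_class (P : Xi_f tr) (A : algebra LX) : Prop :=
  exists (B : Y) (u : hom A (sval (theta tr B))), P (sval B) /\ injective u.

Lemma preimage_quasivariety P : is_quasivariety (preimage_class P).
Proof.
have emb A A' (v : hom A' A) :
    injective v -> preimage_class P A -> preimage_class P A'.
  move=> vI [B [u [PB uI]]]; exists B, (comp_hom u v); split=> //.
  exact: inj_comp.
split.
- by move=> A A' /isomorphic_sym[v /bij_inj vI]; exact: emb vI.
- by move=> A S; apply: emb; exact: inclusion_inj.
- move=> I F A FF hA.
  have /choice[B /dep_choice[u uP]] : forall i, exists B : Y,
      exists u : hom (A i) (sval (theta tr B)), P (sval B) /\ injective u.
    by move=> i; exact: hA.
  have [w [wI _]] := theta_reduced_product FF u.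
  exists (red_obj FF B), w; split; last by apply: wI => i; case: (uP i).
  by apply: (closed_red (Xi_f_qv P)) => i; case: (uP i).
Qed.

Lemma preimage_sub P A : preimage_class P A -> X A.
Proof.
by move=> [B [u [_ uI]]]; apply: (closed_embedding (qvP X) uI); exact: svalP.
Qed.

Definition preimage (P : Xi_f tr) : Xi X :=
  MkXi (preimage_quasivariety P) (@preimage_sub P).

Section Sober.
Variables (F : functor X Y) (adj : adjunction F (theta tr)).
Hypothesis sober_adj : sober_for adj.

(** The triangle identity exhibits a fixed point [a] as the image, under the
    counit, of the value at [a] of the unit. *)
Lemma counit_fixed (A : Y) (a : sval A) : sel_fixed tr a ->
  exists b, (counit_ adj A : hom _ _) b = a.
Proof.
move=> fa; pose a' : sval (theta tr A) := exist _ a fa.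
exists (sval ((unit_ adj (theta tr A) : hom _ _) a')).
pose value (u : mor (theta tr A) (theta tr A)) := sval ((u : hom _ _) a').
exact: (congr1 value (triangle_right adj A)).
Qed.

Lemma theta_embedding_reflects (P : Xi_f tr) (A B : Y)
    (u : mor (theta tr A) (theta tr B)) :
  injective (u : hom _ _) -> P (sval B) -> P (sval A).
Proof.
case: sober_adj => _ counitI FI uI PB; apply: Xi_f_up_closed.
apply: (up_intro (m := counit_ adj A : hom _ _) (Xi_f_qv P) (svalP A)).
- pose v : hom (sval (F (theta tr A))) (sval B) := mor_comp (counit_ adj B) (Defs.fmap F u).
  apply: (closed_embedding (u := v) (Xi_f_qv P) _ PB).
  by apply: inj_comp; [exact: counitI|exact: FI].
- exact: counitI.
- exact: counit_fixed.
Qed.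

Lemma preimageK : cancel preimage tau.
Proof.
move=> P; apply: Xi_f_ext => A /=; split=> [[YA [B [u [PB uI]]]]|PA].
  exact: (@theta_embedding_reflects P (exist _ A YA) B u).
exists (Xi_f_sub PA), (exist _ A (Xi_f_sub PA)), (id_hom _).
by split=> // x y; apply.
Qed.

Lemma isomorphic_theta_F (A : X) : isomorphic (sval A) (sval (theta tr (F A))).
Proof.
case: sober_adj => /(_ A)[v [vK Kv]] _ _; exists (unit_ adj A : hom _ _).
exists (v : hom _ _) => x.
  by have /(congr1 (fun w : hom _ _ => w x)) := vK.
by have /(congr1 (fun w : hom _ _ => w x)) := Kv.
Qed.

(** Reflecting the order uses only that every [A] in [X] is, up to isomorphism,
    in the image of [theta]: it belongs to [K] exactly when [F A] belongs to
    [tau K]. *)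
Lemma tau_le : {mono tau : K K' / (K <= K')%O}.
Proof.
move=> K K'; apply/asboolP/asboolP => KK' A; last first.
  by move=> /= [YA KA]; exists YA; exact: KK'.
move=> KA; have AF := isomorphic_theta_F (exist _ A (Xi_sub KA)).
apply: (closed_iso (Xi_qv K') (isomorphic_sym AF)); apply/tau_classE.
by apply: KK'; apply/tau_classE; exact: (closed_iso (Xi_qv K) AF).
Qed.

End Sober.
End Tau.

Theorem proposition6p14 (LX LY : signature)
  (X : quasivariety LX) (Y : quasivariety LY) (V : infinite_type)
  (tr : selective_translation V X Y) (tr_sober : sober tr) :
  exists tau : Xi X -> Xi_f tr,
    [/\ forall (K : Xi X) (A : algebra LY), tau K A <-> tau_class tr K A,
        bijective tau,
        Order.meet_morphism tau
      & Order.join_morphism tau].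
Proof.
case: tr_sober => F [adj sober_adj].
have tauK := preimageK sober_adj; have tau_mono := tau_le sober_adj.
exists (tau tr); split=> //.
- exists (preimage (tr := tr)) => // K.
  by apply: (Order.POrderTheory.inc_inj tau_mono); rewrite tauK.
- exact: order_iso_meet tau_mono tauK.
- exact: order_iso_join tau_mono tauK.
Qed.
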